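(* Let $(X,\mathcal{A},\mu)$ be a probability space and let $S,T:X\to X$ be a pair of ergodic, commuting, invertible, measure preserving transformations such that $\mu(\{x\in X: S^iT^jx=x\})=0$ for all $(i,j)\in\mathbb{Z}^2$ with $(i,j)\neq(0,0)$. Let $\{R_n\}_{n\in\mathbb{N}}$ be a process and let $1\leq p<\infty$. The following are equivalent. (i) Given any $f\in L^p(X)$, the limit $$\lim_{n\to\infty}M_nf(x)=\lim_{n\to\infty}\frac{1}{\#(R_n\cap\mathbb{Z}^2)}\sum_{(i,j)\in R_n\cap\mathbb{Z}^2}f(S^iT^jx)$$ exists for almost every $x\in X$. (ii) The maximal operator $M^*$ is of weak-type $(p,p)$.
   Context: For a rectangle $R\subset\mathbb{R}^2$ (not necessarily with sides parallel to the coordinate axes), $l(R)$ is the length of its shortest side. A process is a sequence $\{R_n\}_{n\in\mathbb{N}}$ of rectangles of $\mathbb{R}^2$, each containing the point $(0,0)$, with $l(R_n)\to\infty$ as $n\to\infty$. For $f:X\to\mathbb{R}$, $$M_nf(x)=\frac{1}{\#(R_n\cap\mathbb{Z}^2)}\sum_{(i,j)\in R_n\cap\mathbb{Z}^2}f(S^iT^jx),\qquad M^*f=\sup_{n\in\mathbb{N}}M_n|f|.$$ For $1\leq p<\infty$, $M^*$ is of weak-type $(p,p)$ if there exists a constant $C>0$ such that for any $f\in L^p(X)$ and any $\lambda>0$ one has $\mu(\{x\in X: M^*f(x)>\lambda\})\leq C\left(\|f\|_{L^p(X)}/\lambda\right)^p$. *)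

(* Defs.v *)
From HB Require Import structures.
From mathcomp Require Import all_boot all_order all_algebra finmap.
From mathcomp Require Import all_classical all_reals all_analysis.
Set Implicit Arguments.
Unset Strict Implicit.
Unset Printing Implicit Defensive.
Import Order.TTheory GRing.Theory Num.Theory.
Import numFieldNormedType.Exports.
Local Open Scope classical_set_scope.
Local Open Scope ring_scope.

Definition vnorm (R : realType) (u : R * R) : R :=
  Num.sqrt (u.1 ^+ 2 + u.2 ^+ 2).

(* A (closed, nondegenerate) rectangle in arbitrary position, presented by a
   vertex and the two orthogonal side vectors issued from that vertex. *)
Record rectangle (R : realType) := Rectangle {
  rect_vertex : R * R ;
  rect_side1 : R * R ;
  rect_side2 : R * R ;
  rect_side1_neq0 : rect_side1 != 0 ;
  rect_side2_neq0 : rect_side2 != 0 ;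
  rect_orthogonal :
    rect_side1.1 * rect_side2.1 + rect_side1.2 * rect_side2.2 = 0 }.

Definition rect_set (R : realType) (Q : rectangle R) : set (R * R) :=
  [set z | exists s t : R, [/\ 0 <= s <= 1, 0 <= t <= 1,
     z.1 = (rect_vertex Q).1 + s * (rect_side1 Q).1 + t * (rect_side2 Q).1 &
     z.2 = (rect_vertex Q).2 + s * (rect_side1 Q).2 + t * (rect_side2 Q).2]].

Definition shortest_side (R : realType) (Q : rectangle R) : R :=
  Num.min (vnorm (rect_side1 Q)) (vnorm (rect_side2 Q)).

Definition is_process (R : realType) (Rn : nat -> rectangle R) : Prop :=
  (forall n, rect_set (Rn n) (0, 0)) /\
  shortest_side (Rn n) @[n --> \oo] --> +oo.

Definition lattice_pts (R : realType) (Q : rectangle R) : set (int * int) :=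
  [set ij | rect_set Q (ij.1%:~R, ij.2%:~R)].

Lemma finite_int_ball (R : realType) (B : R) :
  finite_set [set i : int | `|i%:~R| <= B].
Proof.
pose N := (Num.truncn B).+1.
apply: (@sub_finite_set _ _
  ((fun bn : bool * nat => (-1) ^+ bn.1 * bn.2%:Z) @` ([set: bool] `*` `I_N))).
  move=> i /= iB; exists (i < 0, absz i) => /=; last first.
    by rewrite {3}(intEsign i).
  split=> //; rewrite -(ltr_nat R) /N.
  rewrite (le_lt_trans _ (truncnS_gt B))//.
  by rewrite pmulrn abszE intr_norm.
by apply: finite_image; apply: finite_setX => //; exact: finite_II.
Qed.

Lemma finite_lattice_pts (R : realType) (Q : rectangle R) :
  finite_set (lattice_pts Q).
Proof.
pose c := rect_vertex Q; pose u := rect_side1 Q; pose v := rect_side2 Q.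
have bnd (s t a b e : R) : 0 <= s <= 1 -> 0 <= t <= 1 ->
    `|a + s * b + t * e| <= `|a| + `|b| + `|e|.
  move=> /andP[s0 s1] /andP[t0 t1].
  rewrite (le_trans (ler_normD _ _))// lerD//.
    rewrite (le_trans (ler_normD _ _))// lerD2l normrM (ger0_norm s0).
    by rewrite ler_piMl.
  by rewrite normrM (ger0_norm t0) ler_piMl.
apply: (@sub_finite_set _ _
  ([set i : int | `|i%:~R| <= `|c.1| + `|u.1| + `|v.1|] `*`
   [set i : int | `|i%:~R| <= `|c.2| + `|u.2| + `|v.2|])).
  by move=> [i j] /= [s [t [s01 t01 /= -> ->]]]; split; exact: bnd.
by apply: finite_setX; exact: finite_int_ball.
Qed.

Definition measure_preserving d (X : measurableType d) (R : realType)
    (mu : {measure set X -> \bar R}) (f : X -> X) : Prop :=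
  measurable_fun [set: X] f /\
  forall A, measurable A -> mu (f @^-1` A) = mu A.

Record invertible_mpt d (X : measurableType d) (R : realType)
    (mu : {measure set X -> \bar R}) := InvertibleMPT {
  mpt_fun :> X -> X ;
  mpt_inv : X -> X ;
  mpt_funK : cancel mpt_fun mpt_inv ;
  mpt_invK : cancel mpt_inv mpt_fun ;
  mpt_fun_mp : measure_preserving mu mpt_fun ;
  mpt_inv_mp : measure_preserving mu mpt_inv }.

Definition ergodic d (X : measurableType d) (R : realType)
    (mu : probability X R) (f : X -> X) : Prop :=
  forall A, measurable A -> f @^-1` A = A -> mu A = 0%E \/ mu A = 1%E.

Definition mpt_iter d (X : measurableType d) (R : realType)
    (mu : {measure set X -> \bar R}) (S : invertible_mpt mu) (i : int)
    (x : X) : X :=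
  match i with
  | Posz n => iter n S x
  | Negz n => iter n.+1 (mpt_inv S) x
  end.

Section averages.
Context d (X : measurableType d) (R : realType) (mu : probability X R).
Variables (S T : invertible_mpt mu) (Rn : nat -> rectangle R).

Definition ergodic_avg (n : nat) (f : X -> R) (x : X) : R :=
  (#|` fset_set (lattice_pts (Rn n))|%:R)^-1 *
  \sum_(ij \in lattice_pts (Rn n)) f (mpt_iter S ij.1 (mpt_iter T ij.2 x)).

Definition maximal_op (f : X -> R) (x : X) : \bar R :=
  ereal_sup [set (ergodic_avg n (fun y => `|f y|) x)%:E | n in [set: nat]].

End averages.

Definition weak_type d (X : measurableType d) (R : realType)
    (mu : probability X R) (p : R) (M : (X -> R) -> X -> \bar R) : Prop :=
  exists2 C : R, 0 < C &
    forall f : X -> R, f \in Lfun mu p%:E -> forall lambda : R, 0 < lambda ->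
    (mu [set x | lambda%:E < M f x] <=
       (C * (fine ('N[mu]_(p%:E)[EFin \o f]) / lambda) `^ p)%:E)%E.

(* Main.v *)
Require Import Defs.
From HB Require Import structures.
From mathcomp Require Import all_boot all_order all_algebra finmap.
From mathcomp Require Import all_classical all_reals all_analysis.
From mathcomp Require Import measurable_realfun ring lra.
Set Implicit Arguments.
Unset Strict Implicit.
Unset Printing Implicit Defensive.
Import Order.TTheory GRing.Theory Num.Theory.
Import numFieldNormedType.Exports.
Local Open Scope classical_set_scope.
Local Open Scope ring_scope.

(** (i) => (ii) is Sawyer's argument.  If M^* is not of weak type (p,p) there are
    g_k >= 0 whose sets E_k = {M^* g_k > 1} are much larger than the p-th moment
    of g_k.  Ergodicity of S allows one to cover half of X by about 1 / mu(E_k)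
    translates S^{-m} E_k, and the p-sum of the functions (k+1) g_k o S^m over
    all k and all the translates used is the p-th power of a function F in L^p.
    As M^* commutes with S, M^* F = oo on the set of points lying in infinitely
    many of the covers, which has measure at least 1/2, so M_n F diverges there.

    (ii) => (i) is the Banach principle.  Each f in L^p is g + h with g bounded
    and h small; replacing g by a long time average of g along S changes M_n g
    by o(1), since left ends of rows are negligible among the lattice points of
    R_n, and this time average is close in L^p to a constant.  Hence M_n f is
    within o(1) of a constant plus M_n of a function of small L^p norm, to which
    the weak type inequality applies. *)

(** * Lattice points of rectangles *)

Section rectangle_geometry.
Context (R : realType).
Implicit Types (u v e : R * R) (Q : rectangle R).

Lemma vnorm_ge_abs u : `|u.1| <= vnorm u /\ `|u.2| <= vnorm u.
Proof.
rewrite /vnorm -!sqrtr_sqr; split; rewrite ler_wsqrtr//.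
  by rewrite lerDl sqr_ge0.
by rewrite lerDr sqr_ge0.
Qed.

Lemma sqr_vnorm u : vnorm u ^+ 2 = u.1 ^+ 2 + u.2 ^+ 2.
Proof. by rewrite sqr_sqrtr// addr_ge0 ?sqr_ge0. Qed.

Lemma sqr_vnorm_gt0 u : u != 0 -> 0 < u.1 ^+ 2 + u.2 ^+ 2.
Proof.
move=> u0; rewrite lt_neqAle addr_ge0 ?sqr_ge0// andbT eq_sym.
rewrite paddr_eq0 ?sqr_ge0// !sqrf_eq0; apply: contra u0 => /andP[/eqP u1 /eqP u2].
by apply/eqP; case: u u1 u2 => a b /= -> ->.
Qed.

(** The numerator is at most [(|e.1| + |e.2|) * vnorm u], hence at most a quarter of
    [vnorm u ^+ 2]. *)
Lemma coordinate_small u e : u != 0 ->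
  4 * (`|e.1| + `|e.2|) <= vnorm u ->
  `|(e.1 * u.1 + e.2 * u.2) / (u.1 ^+ 2 + u.2 ^+ 2)| <= 4^-1.
Proof.
move=> u0 eu; have p := sqr_vnorm_gt0 u0.
rewrite normrM normfV (gtr0_norm p) ler_pdivrMr// -sqr_vnorm.
have [u1 u2] := vnorm_ge_abs u.
rewrite (le_trans (ler_normD _ _))// !normrM.
have n0 : 0 <= vnorm u by rewrite sqrtr_ge0.
have h1 := ler_wpM2l (normr_ge0 e.1) u1.
have h2 := ler_wpM2l (normr_ge0 e.2) u2.
have h3 := ler_wpM2r n0 eu.
rewrite -expr2 in h3; lra.
Qed.

Lemma orthogonal_decomposition u v e : u != 0 -> v != 0 ->
  u.1 * v.1 + u.2 * v.2 = 0 ->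
  let a := (e.1 * u.1 + e.2 * u.2) / (u.1 ^+ 2 + u.2 ^+ 2) in
  let b := (e.1 * v.1 + e.2 * v.2) / (v.1 ^+ 2 + v.2 ^+ 2) in
  e.1 = a * u.1 + b * v.1 /\ e.2 = a * u.2 + b * v.2.
Proof.
move=> /sqr_vnorm_gt0 + /sqr_vnorm_gt0; case: u => u1 u2; case: v => v1 v2.
case: e => e1 e2 /= up vp uv.
have un := lt0r_neq0 up; have vn := lt0r_neq0 vp.
(* A plane vector orthogonal to [u] is a multiple [k] of [(- u2, u1)]; after this substitution both
   claims are field identities. *)
pose k := (u1 * v2 - u2 * v1) / (u1 ^+ 2 + u2 ^+ 2).
have v1E : v1 = - (k * u2).
  apply: (mulIf un); rewrite /k.
  transitivity (- (u1 * v2 - u2 * v1) * u2); last by field.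
  transitivity (u2 ^+ 2 * v1 + (u1 * v1) * u1); first by ring.
  have -> : u1 * v1 = - (u2 * v2) by apply/eqP; rewrite -addr_eq0 uv.
  by ring.
have v2E : v2 = k * u1.
  apply: (mulIf un); rewrite /k.
  transitivity ((u1 * v2 - u2 * v1) * u1); last by field.
  transitivity (u1 ^+ 2 * v2 + (u2 * v2) * u2); first by ring.
  have -> : u2 * v2 = - (u1 * v1) by apply/eqP; rewrite -addr_eq0 addrC uv.
  by ring.
clearbody k; subst v1 v2.
have k0 : k != 0.
  by apply: contra vn => /eqP ->; rewrite !mul0r oppr0 expr0n addr0.
have kE : (- (k * u2)) ^+ 2 + (k * u1) ^+ 2 = k ^+ 2 * (u1 ^+ 2 + u2 ^+ 2).
  by ring.
rewrite kE; split; field; by rewrite un k0.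
Qed.

(** By orthogonality the displacement [e] changes each side parameter by at most 1/4, so parameters
    in [[1/4, 3/4]] stay in [[0, 1]]. *)
Lemma rect_set_ball Q (s t : R) e :
  4^-1 <= s <= 3 / 4 -> 4^-1 <= t <= 3 / 4 ->
  4 * (`|e.1| + `|e.2|) <= shortest_side Q ->
  rect_set Q ((rect_vertex Q).1 + s * (rect_side1 Q).1 + t * (rect_side2 Q).1 + e.1,
              (rect_vertex Q).2 + s * (rect_side1 Q).2 + t * (rect_side2 Q).2 + e.2).
Proof.
move=> /andP[s1 s2] /andP[t1 t2]; rewrite /shortest_side le_min => /andP[eu ev].
have u0 := rect_side1_neq0 Q; have v0 := rect_side2_neq0 Q.
have := coordinate_small v0 ev; have := coordinate_small u0 eu.
have [] := orthogonal_decomposition e u0 v0 (rect_orthogonal Q).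
set a := _ / _; set b := _ / _.
move=> e1E e2E /[swap]; rewrite !ler_norml => /andP[b1 b2] /andP[a1 a2].
exists (s + a), (t + b); split; [by apply/andP; split; lra..| |].
- by rewrite /= {1}e1E; ring.
- by rewrite /= {1}e2E; ring.
Qed.

(* From any point of the rectangle one of the four vectors [(+-u +-v) / 4] leads
   to a point at distance at least a quarter of the shortest side from the
   boundary; rounding the vector keeps the shifted row of lattice points inside. *)
Definition quarter_shift u v (c : bool * bool) : int * int :=
  (Num.floor ((-1) ^+ c.1 * u.1 / 4 + (-1) ^+ c.2 * v.1 / 4),
   Num.floor ((-1) ^+ c.1 * u.2 / 4 + (-1) ^+ c.2 * v.2 / 4)).

Lemma floor_err (x : R) : -1 <= (Num.floor x)%:~R - x <= 0.
Proof.
have /andP[] := floor_itv x; rewrite intrD => h1 h2.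
by apply/andP; split; lra.
Qed.

Lemma quarter_coordinate (s : R) : 0 <= s <= 1 ->
  exists b : bool, 4^-1 <= s + (-1) ^+ b / 4 <= 3 / 4.
Proof.
move=> s01; have [h|h] := leP s 2^-1; [exists false|exists true];
  rewrite ?expr0 ?expr1; move: s01 => /andP[s0 s1]; apply/andP; split; lra.
Qed.

Lemma lattice_pts_row Q (N : nat) (z : int * int) :
  4 * (N.+1%:R + 1) <= shortest_side Q -> lattice_pts Q z ->
  exists c : bool * bool, forall k : nat, (k <= N)%N ->
    lattice_pts Q
      (z.1 + (quarter_shift (rect_side1 Q) (rect_side2 Q) c).1 + k%:Z,
       z.2 + (quarter_shift (rect_side1 Q) (rect_side2 Q) c).2).
Proof.
move=> lQ [s [t [s01 t01 /= z1 z2]]].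
have [c1 sc] := quarter_coordinate s01; have [c2 tc] := quarter_coordinate t01.
exists (c1, c2) => k kN; rewrite /lattice_pts /= !intrD.
set w1 := _ / 4 + _ / 4; set w2 := (X in z.2%:~R + (Num.floor X)%:~R).
have /andP[e1 e1'] := floor_err w1; have /andP[e2 e2'] := floor_err w2.
have kN' : k%:R <= N%:R :> R by rewrite ler_nat.
have k0 : 0 <= k%:R :> R by [].
have := @rect_set_ball Q _ _
  ((Num.floor w1)%:~R - w1 + k%:R, (Num.floor w2)%:~R - w2) sc tc.
rewrite /= => /(_ _).
(* Rounding down moves each coordinate by at most 1 and [k] is at most [N], so the displacement is
   at most [N + 2] in total. *)
have H : 4 * (`|(Num.floor w1)%:~R - w1 + k%:R| + `|(Num.floor w2)%:~R - w2|)
    <= shortest_side Q.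
  apply: le_trans lQ; rewrite ler_pM2l//; apply: lerD.
    by rewrite ler_norml -natr1; apply/andP; split; lra.
  by rewrite ler_norml; apply/andP; split; lra.
move=> /(_ H); congr (rect_set Q); congr pair.
  by rewrite z1 -pmulrn /w1 /=; ring.
by rewrite z2 /w2 /=; ring.
Qed.

(** A rectangle is convex: the side parameters of [(k, j)] interpolate those of the two ends with
    weight [a], once the case [i = i'], where [a] would divide by 0, is set aside. *)
Lemma lattice_pts_convex_row Q (i i' k j : int) : (i <= k <= i')%R ->
  lattice_pts Q (i, j) -> lattice_pts Q (i', j) -> lattice_pts Q (k, j).
Proof.
move=> /andP[ik ki'] h h'.
have [ii'|ii'] := eqVneq i i'.
  by have -> : k = i by apply/le_anti; rewrite ik ii' ki'.
have lt : (i < i')%R by rewrite lt_neqAle ii' (le_trans ik).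
move: h h' => [s [t [/andP[s0 s1] /andP[t0 t1] /= z1 z2]]].
move=> [s' [t' [/andP[s0' s1'] /andP[t0' t1'] /= z1' z2']]].
pose a : R := (k - i)%:~R / (i' - i)%:~R.
have p : (0 : R) < (i' - i)%:~R by rewrite ltr0z subr_gt0.
have a0 : 0 <= a by rewrite divr_ge0 ?ler0z ?subr_ge0// ltW.
have a1 : 0 <= 1 - a.
  by rewrite subr_ge0 ler_pdivrMr// mul1r ler_int lerD2r.
have cvx (x y : R) : 0 <= x -> x <= 1 -> 0 <= y -> y <= 1 ->
    0 <= (1 - a) * x + a * y <= 1.
  move=> x0 x1 y0 y1; rewrite addr_ge0 ?(mulr_ge0 a0) ?(mulr_ge0 a1)//=.
  have := ler_wpM2l a1 x1; have := ler_wpM2l a0 y1; lra.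
exists ((1 - a) * s + a * s'), ((1 - a) * t + a * t'); split; [exact: cvx|exact: cvx| |].
  rewrite /=.
  have -> : k%:~R = (1 - a) * i%:~R + a * i'%:~R :> R.
    have -> : (1 - a) * i%:~R + a * i'%:~R = i%:~R + a * (i'%:~R - i%:~R) :> R.
      by ring.
    by rewrite -intrB /a divfK ?lt0r_neq0// intrB; ring.
  by rewrite z1 z1'; ring.
rewrite /=; transitivity ((1 - a) * j%:~R + a * j%:~R); first by ring.
by rewrite {1}z2 z2'; ring.
Qed.

(** These points are the boundary seen by a shift along rows. Convexity of a rectangle leaves
    exactly one of them in each nonempty row of its lattice points. *)
Definition left_end (L : {fset int * int}) : {fset int * int} :=
  [fset z in L | (z.1 - 1, z.2) \notin L]%fset.

(* The shifts of [N + 1] consecutive points by one of four fixed vectors are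
   disjoint for distinct left ends, because these lie on distinct rows. *)
Lemma card_left_end Q (N : nat) :
  let L := fset_set (lattice_pts Q) in
  4 * (N.+1%:R + 1) <= shortest_side Q ->
  (N.+1 * #|` left_end L| <= 4 * #|` L|)%N.
Proof.
move=> L lQ.
have inL z : (z \in L) = (z \in lattice_pts Q).
  by rewrite in_fset_set//; exact: finite_lattice_pts.
pose sh := quarter_shift (rect_side1 Q) (rect_side2 Q).
pose f c (z : int * int) (k : nat) := (z.1 + (sh c).1 + k%:Z, z.2 + (sh c).2).
pose P c z := all (fun k => f c z k \in L) (iota 0 N.+1).
have Pz z : z \in L -> exists c, P c z.
  rewrite inL => /set_mem /(lattice_pts_row lQ)[c h]; exists c.
  apply/allP => k; rewrite mem_iota add0n /= ltnS => kN.
  by rewrite inL; apply/mem_set/h.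
(* If two distinct left ends shared a row, the left neighbour of the right one would lie between
   them, hence in [L] by convexity. *)
have inj z z' : z \in left_end L -> z' \in left_end L -> z.2 = z'.2 -> z = z'.
  wlog le : z z' / (z.1 <= z'.1)%R => [H zE zE' e|].
    have [/H->//|/ltW/H->//] := leP z.1 z'.1.
  case: z z' le => [i j] [i' j'] /= ii'.
  rewrite !inE /= => /andP[zL _] /andP[zL' zN'] jj'; subst j'.
  congr pair; apply/eqP; rewrite eq_le ii' /= leNgt; apply/negP => lt.
  move: zN'; rewrite inL => /negP; apply; apply/mem_set.
  move: zL zL'; rewrite !inL => /set_mem zL /set_mem zL'.
  apply: (lattice_pts_convex_row _ zL zL').
  by rewrite gerBl// andbT lerBrDr -ltzD1 ltrD2r.
have cnt c : (N.+1 * count (P c) (left_end L) <= #|` L|)%N.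
  pose E := [seq z <- left_end L | P c z].
  rewrite -size_filter -/E.
  have <- : size [seq f c z k | z <- E, k <- iota 0 N.+1] = (N.+1 * size E)%N.
    by rewrite size_allpairs size_iota mulnC.
  apply: uniq_leq_size.
    apply: allpairs_uniq; [exact/filter_uniq/fset_uniq|exact: iota_uniq|].
    move=> [z k] [z' k'] /allpairsP[yl [yE _ [-> ->]]].
    move=> /allpairsP[yl' [yE' _ [-> ->]]] [+ e2].
    move: yE yE'; rewrite !mem_filter => /andP[_ yE] /andP[_ yE'].
    have -> := inj _ _ yE yE' (addIr _ e2).
    by move=> /addrI [->].
  move=> y /allpairsP[[z k] /= [zE kN ->]].
  by move: zE; rewrite mem_filter => /andP[/allP/(_ _ kN)].
(* Every left end has some good shift [c], so the four counts add up to at least the number of left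
   ends. *)
have : (#|` left_end L| <= \sum_(c : bool * bool) count (P c) (left_end L))%N.
  rewrite -sum1_size.
  under [leqRHS]eq_bigr do rewrite -sum1_count big_mkcond.
  rewrite exchange_big /= !big_seq; apply: leq_sum => z.
  rewrite !inE => /andP[/Pz[c Pc] _].
  by rewrite (bigD1 c)//= Pc.
rewrite -(leq_pmul2l (ltn0Sn N)) => /leq_trans; apply.
rewrite big_distrr /=; apply: (@leq_trans (\sum_(c : bool * bool) #|` L|)).
  by apply: leq_sum.
by rewrite sum_nat_const card_prod card_bool.
Qed.

End rectangle_geometry.

(** * Asymptotic invariance of lattice sums under row shifts *)

Section row_shift.
Context (R : realType).

(** The sums over [L] and over its shift [L'] agree on the common part. What remains is [left_end L]
    on one side and a set of the same cardinality on the other, because [L] and [L'] have equally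
    many points. *)
Lemma sum_row_shift (L : {fset int * int}) (K : R) (g : int * int -> R) :
  (forall z, `|g z| <= K) ->
  `|\sum_(z <- L) g (z.1 + 1, z.2) - \sum_(z <- L) g z| <=
    2 * K * #|` left_end L|%:R.
Proof.
move=> gK; pose sh (z : int * int) : int * int := (z.1 + 1, z.2).
have sh_inj : injective sh by move=> [a b] [a' b'] [/addIr -> ->].
pose L' := [fset sh z | z in L]%fset.
have -> : \sum_(z <- L) g (z.1 + 1, z.2) = \sum_(z <- L') g z.
  by rewrite big_imfset//= => x y _ _; exact: sh_inj.
have LE : (L `\` L' = left_end L)%fset.
  apply/fsetP => z; rewrite !inE andbC; congr (_ && ~~ _).
  apply/imfsetP/idP => [[y /= yL ->]|zL]; first by rewrite /= addrK -surjective_pairing.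
  by exists (z.1 - 1, z.2) => //; rewrite /sh /= subrK -surjective_pairing.
have cL' : #|` L'| = #|` L| by rewrite card_imfset.
have LE' : #|` L' `\` L|%fset = #|` left_end L|.
  by rewrite -LE !cardfsD cL' fsetIC.
have bnd (A : {fset int * int}) : `|\sum_(z <- A) g z| <= K * #|` A|%:R.
  rewrite (le_trans (ler_norm_sum _ _ _))//.
  rewrite (le_trans (ler_sum _ (fun z _ => gK z)))//.
  by rewrite big_const_seq count_predT iter_addr addr0 mulr_natr.
have split (A B : {fset int * int}) : \sum_(z <- A) g z =
    \sum_(z <- (A `&` B)%fset) g z + \sum_(z <- (A `\` B)%fset) g z.
  rewrite (big_fsetID _ (mem B) A) /=; congr (_ + _).
    by apply: eq_fbigl => z; rewrite !inE.
  by apply: eq_fbigl => z; rewrite !inE andbC.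
rewrite (split L' L) (split L L') fsetIC opprD addrACA subrr add0r LE.
rewrite (le_trans (ler_normB _ _))// -mulrA mulr_natl mulr2n lerD//.
by rewrite -LE'.
Qed.

Lemma process_row_shift (Rn : nat -> rectangle R) (e : R) :
  is_process Rn -> 0 < e ->
  \forall n \near \oo, forall (K : R) (g : int * int -> R),
    let L := fset_set (lattice_pts (Rn n)) in
    (forall z, `|g z| <= K) ->
    `|\sum_(z <- L) g (z.1 + 1, z.2) - \sum_(z <- L) g z| <=
      e * K * #|` L|%:R.
Proof.
(* With this [N], [card_left_end] bounds twice the number of left ends by [8 / (N + 1)], hence by
   [e], times the number of lattice points. *)
move=> [_ ell] e0; pose N := Num.truncn (8 / e).
have Ne : 8 <= e * N.+1%:R.
  by rewrite mulrC -ler_pdivrMr// ltW// truncnS_gt.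
move/cvgryPge : ell => /(_ (4 * (N.+1%:R + 1))); apply: filterS => n /= ln K g gK.
rewrite (le_trans (sum_row_shift _ gK))//.
have := card_left_end ln; set E := #|` _|; set L := #|` _|.
rewrite -(ler_nat R) !natrM => h.
have K0 : 0 <= K by rewrite (le_trans _ (gK (0, 0))).
have h1 := ler_wpM2r (ler0n R E) Ne; rewrite -[X in _ <= X]mulrA in h1.
have h2 := ler_wpM2l (ltW e0) h.
rewrite -mulrA [2 * _]mulrC -[leLHS]mulrA [e * K]mulrC -[leRHS]mulrA ler_wpM2l//.
lra.
Qed.

End row_shift.

(** * Birkhoff's theorem for bounded functions *)

Section ergodic_theorem.
Context d (X : measurableType d) (R : realType) (mu : probability X R).
Implicit Types (f g : X -> R) (S : X -> X).

(** The bound holds at every point rather than almost everywhere, so it passes to compositions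
    without null sets. *)
Definition bounded_mfun f :=
  measurable_fun [set: X] f /\ exists K : R, forall x, `|f x| <= K.

Lemma bounded_mfun_cst (c : R) : bounded_mfun (fun=> c).
Proof. by split; [exact: measurable_cst|exists `|c|]. Qed.

Lemma bounded_mfunD f g : bounded_mfun f -> bounded_mfun g ->
  bounded_mfun (fun x => f x + g x).
Proof.
move=> [mf [K fK]] [mg [L gL]]; split; first exact: measurable_funD.
by exists (K + L) => x; rewrite (le_trans (ler_normD _ _))// lerD.
Qed.

Lemma bounded_mfunN f : bounded_mfun f -> bounded_mfun (fun x => - f x).
Proof.
move=> [mf [K fK]]; split; first exact: measurableT_comp.
by exists K => x; rewrite normrN.
Qed.

Lemma bounded_mfun_max0 f : bounded_mfun f ->
  bounded_mfun (fun x => Num.max 0 (f x)).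
Proof.
move=> [mf [K fK]]; split.
  by apply: measurable_maxr => //; exact: measurable_cst.
exists K => x; rewrite ger0_norm ?le_max ?lexx// ge_max.
by rewrite (le_trans _ (fK x))//= (le_trans (ler_norm _) (fK x)).
Qed.

Lemma bounded_mfun_comp S f : measurable_fun [set: X] S -> bounded_mfun f ->
  bounded_mfun (fun x => f (S x)).
Proof.
move=> mS [mf [K fK]]; split; last by exists K.
exact: (measurableT_comp mf mS).
Qed.

Lemma bounded_mfun_integrable f : bounded_mfun f ->
  mu.-integrable [set: X] (EFin \o f).
Proof.
move=> [mf [K fK]]; apply: measurable_bounded_integrable => //.
  by rewrite -ge0_fin_numE ?fin_num_measure.
by exists K; split; [exact: num_real|move=> M /ltW KM x _; exact: le_trans KM].
Qed.

Lemma measure_preserving_iter S n : measure_preserving mu S ->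
  measure_preserving mu (iter n S).
Proof.
move=> [mS hS]; elim: n => [|n [mI hI]]; first by split; [exact: measurable_id|].
split; first exact: (measurableT_comp mS mI).
move=> A mA; rewrite -(hS _ mA) -(hI (S @^-1` A))//.
by rewrite -[_ @^-1` _]setTI; exact: mS.
Qed.

Lemma ge0_integral_measure_preserving S (f : X -> \bar R) :
  measure_preserving mu S -> measurable_fun [set: X] f -> (forall x, 0 <= f x)%E ->
  (\int[mu]_x f (S x) = \int[mu]_x f x)%E.
Proof.
move=> [mS hS] mf f0.
rewrite -[LHS]/(\int[mu]_(x in S @^-1` [set: X]) (f \o S) x)%E.
rewrite -(ge0_integral_pushforward mS)//.
by apply: eq_measure_integral => A mA _; exact: hS.
Qed.

Lemma Rintegral_measure_preserving S f :
  measure_preserving mu S -> bounded_mfun f ->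
  \int[mu]_x f (S x) = \int[mu]_x f x.
Proof.
move=> [mS hS] bf; rewrite /Rintegral; congr fine.
rewrite -[LHS]/(\int[mu]_(x in S @^-1` [set: X]) ((EFin \o f) \o S) x)%E.
rewrite -(integral_pushforward mS)//.
- by apply: eq_measure_integral => A mA _; exact: hS.
- by apply/measurable_EFinP; case: bf.
- exact/bounded_mfun_integrable/bounded_mfun_comp.
Qed.

Lemma bounded_mfun_Rintegral_cvg (g_ : nat -> X -> R) g (K : R) :
  (forall n, measurable_fun [set: X] (g_ n)) ->
  (forall n x, `|g_ n x| <= K) -> bounded_mfun g ->
  {ae mu, forall x, g_ n x @[n --> \oo] --> g x} ->
  \int[mu]_x g_ n x @[n --> \oo] --> \int[mu]_x g x.
Proof.
move=> mg_ gK bg ag.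
have [] := @dominated_convergence _ _ _ mu setT measurableT
  (fun n x => (g_ n x)%:E) (EFin \o g) (fun=> K%:E).
- by move=> n; apply/measurable_EFinP.
- by apply/measurable_EFinP; case: bg.
- apply: filterS ag => x h _; apply: cvg_EFin => //; exact: nearW.
- exact/bounded_mfun_integrable/bounded_mfun_cst.
- by apply: aeW => x n _; rewrite lee_fin.
move=> _ _ h.
have gf := integrable_fin_num measurableT (bounded_mfun_integrable bg).
by apply: fine_cvg; rewrite fineK.
Qed.

(* [garsia S f n] is the maximum of the Birkhoff sums of length at most [n],
   written recursively as in Garsia's proof of the maximal ergodic theorem. *)
Fixpoint garsia S f (n : nat) (x : X) : R :=
  if n is m.+1 then Num.max 0 (f x + garsia S f m (S x)) else 0.

Lemma garsia_ge0 S f n x : 0 <= garsia S f n x.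
Proof. by case: n => //= n; rewrite le_max lexx. Qed.

Lemma garsia_leS S f n x : garsia S f n x <= garsia S f n.+1 x.
Proof.
elim: n x => [|n IH] x; first by rewrite garsia_ge0.
by rewrite [in leRHS]/= [leLHS]/= ge_max le_max lexx /= le_max lerD2l IH orbT.
Qed.

Lemma garsia_le S f m n x : (m <= n)%N -> garsia S f m x <= garsia S f n x.
Proof.
by move=> mn; apply: (nondecreasing_seqP (garsia S f ^~ x)).1 => // k; exact: garsia_leS.
Qed.

Lemma bounded_mfun_garsia S f n : measurable_fun [set: X] S -> bounded_mfun f ->
  bounded_mfun (garsia S f n).
Proof.
move=> mS bf; elim: n => [|n IH] /=; first exact: bounded_mfun_cst.
apply: bounded_mfun_max0; apply: bounded_mfunD => //.
exact: bounded_mfun_comp.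
Qed.

Lemma birkhoff_sum_le_garsia S f n x :
  \sum_(k < n) f (iter k S x) <= garsia S f n x.
Proof.
elim: n x => [|n IH] x; first by rewrite big_ord0.
rewrite big_ord_recl /= le_max; apply/orP; right; rewrite lerD2l.
by under eq_bigr do rewrite -iterS iterSr; apply: IH.
Qed.

(** The set where the Birkhoff sums are unbounded above, in a countable form that makes it
    measurable. *)
Definition garsia_unbounded S f : set X :=
  \bigcap_k \bigcup_n [set x | k%:R < garsia S f n x].

Lemma measurable_garsia_unbounded S f : measurable_fun [set: X] S ->
  bounded_mfun f -> measurable (garsia_unbounded S f).
Proof.
move=> mS bf; apply: bigcapT_measurable => k; apply: bigcupT_measurable => n.
have [mg _] := bounded_mfun_garsia n mS bf.
have -> : [set x | k%:R < garsia S f n x] =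
    [set: X] `&` garsia S f n @^-1` [set` `]k%:R, +oo[].
  by apply/seteqP; split => x /=; rewrite in_itv/= andbT => // -[].
by apply: mg => //; exact: measurable_itv.
Qed.

(** Up to the cut at 0, [garsia] at [x] is [f x] plus the preceding [garsia] at [S x], and a finite
    amount cannot affect unboundedness. *)
Lemma garsia_unbounded_invariant S f :
  S @^-1` garsia_unbounded S f = garsia_unbounded S f.
Proof.
apply/seteqP; split => x h k _.
(* This level exceeds [k + |f x|], which still leaves [k] after the contribution of [f x]. *)
- have [n _ /= hn] := h (k + Num.truncn (`|f x|)).+1 I.
  exists n.+1 => //=; rewrite lt_max; apply/orP; right.
  have := truncnS_gt `|f x|; have := ler_norm (- f x); rewrite normrN.
  move: hn; rewrite -!natr1 natrD; lra.
- have [n _ /=] := h (k + Num.truncn (`|f x|)).+1 I; case: n => [|n] /=.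
    by rewrite ltNge ler0n.
  rewrite lt_max ltNge ler0n /= => hn; exists n => //=.
  have := truncnS_gt `|f x|; have := ler_norm (f x).
  move: hn; rewrite -!natr1 natrD; lra.
Qed.

(** Integrate [garsia (n + 1) = f + garsia n \o S + h n]. Invariance of the measure and monotonicity
    in [n] give [0 <= \int f + \int h n], and the last integral tends to 0 by dominated
    convergence. *)
Lemma garsia_unbounded_Rintegral_ge0 S f : measure_preserving mu S ->
  bounded_mfun f -> mu (garsia_unbounded S f) = 1%E -> 0 <= \int[mu]_x f x.
Proof.
move=> mpS bf A1; have [mS _] := mpS.
(* [h n] is the defect in [garsia (n + 1) >= f + garsia n \o S]; where the
   sums are unbounded it vanishes for large [n]. *)
pose h n x := Num.max 0 (- (f x + garsia S f n (S x))).
have bG n := bounded_mfun_garsia n mS bf.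
have bGS n := bounded_mfun_comp mS (bG n).
have bh n : bounded_mfun (h n).
  exact/bounded_mfun_max0/bounded_mfunN/bounded_mfunD.
have fh n : 0 <= \int[mu]_x f x + \int[mu]_x h n x.
  have : \int[mu]_x garsia S f n.+1 x =
      \int[mu]_x f x + \int[mu]_x garsia S f n x + \int[mu]_x h n x.
    rewrite -(Rintegral_measure_preserving mpS (bG n)).
    rewrite -RintegralD//; [|exact: bounded_mfun_integrable..].
    rewrite -RintegralD//; [|exact/bounded_mfun_integrable/bounded_mfunD|
      exact: bounded_mfun_integrable].
    apply: eq_Rintegral => x _ /=; rewrite /h.
    by case: (leP 0) => h1; case: (leP 0) => h2; lra.
  have : \int[mu]_x garsia S f n x <= \int[mu]_x garsia S f n.+1 x.
    by apply: le_Rintegral => //; [exact: bounded_mfun_integrable..|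
      move=> x _; exact: garsia_leS].
  lra.
have h0 : \int[mu]_x h n x @[n --> \oo] --> \int[mu]_(x in setT) (0 : R).
  have [mf [K fK]] := bf.
  apply: (@bounded_mfun_Rintegral_cvg _ _ K).
  - by move=> n; case: (bh n).
  - move=> n x; rewrite /h ger0_norm ?le_max ?lexx// ge_max.
    rewrite (le_trans _ (fK x))//= opprD lerBlDr (le_trans (ler_norm _))//.
    by rewrite normrN (le_trans (fK x))// lerDl garsia_ge0.
  - exact: bounded_mfun_cst.
  - exists (~` garsia_unbounded S f); split.
    + exact/measurableC/measurable_garsia_unbounded.
    + have mA := measurable_garsia_unbounded mS bf.
      by rewrite probability_setC// A1 subee.
    + apply: subsetC => x /=; rewrite -garsia_unbounded_invariant => Ax.
      apply/cvgrPdist_le => e e0.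
      have [n0 _ /= hn0] := Ax (Num.truncn (`|f x|)).+1 I.
      exists n0 => // n /= n0n; rewrite /h sub0r normrN.
      have := garsia_le S f (S x) n0n; have := truncnS_gt `|f x|.
      have := ler_norm (- f x); rewrite normrN => h1 h2 h3.
      by case: (leP 0) => h4; [exfalso; clear A1; lra|rewrite normr0 ltW].
rewrite Rintegral_cst// mul0r in h0.
have : \int[mu]_x f x + \int[mu]_x h n x @[n --> \oo] --> \int[mu]_x f x + 0.
  by apply: cvgD => //; exact: cvg_cst.
rewrite addr0 => /cvgr_to_ge; apply.
by apply: nearW.
Qed.

(** Ergodicity makes the invariant set [garsia_unbounded S f] null or full, and full measure would
    force a nonnegative integral. *)
Lemma birkhoff_sums_bounded S f : measure_preserving mu S -> ergodic mu S ->
  bounded_mfun f -> \int[mu]_x f x < 0 ->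
  {ae mu, forall x, exists M, forall n, \sum_(k < n) f (iter k S x) <= M}.
Proof.
move=> mpS eS bf fneg; have [mS _] := mpS.
have mA := measurable_garsia_unbounded mS bf.
have [A0|A1] := eS _ mA (garsia_unbounded_invariant S f); last first.
  by have := garsia_unbounded_Rintegral_ge0 mpS bf A1; rewrite leNgt fneg.
exists (garsia_unbounded S f); split=> //.
move=> x /= nbd k _; apply: contrapT => nk; apply: nbd; exists k%:R => n.
rewrite (le_trans (birkhoff_sum_le_garsia _ _ _ _))// leNgt; apply/negP => h.
by apply: nk; exists n.
Qed.

Definition time_avg S f (n : nat) (x : X) : R :=
  n.+1%:R^-1 * \sum_(k < n.+1) f (iter k S x).

Lemma Rintegral_bounded_mfunD_cst f (c : R) : bounded_mfun f ->
  \int[mu]_x (f x + c) = \int[mu]_x f x + c.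
Proof.
move=> bf; rewrite RintegralD//; [|exact: bounded_mfun_integrable|
  exact/bounded_mfun_integrable/bounded_mfun_cst].
by rewrite Rintegral_cst//= [X in fine X]probability_setT mulr1.
Qed.

Lemma time_avg_limsup S f (e : R) : measure_preserving mu S -> ergodic mu S ->
  bounded_mfun f -> 0 < e ->
  {ae mu, forall x, \forall n \near \oo, time_avg S f n x <= \int[mu]_x f x + e}.
Proof.
move=> mpS eS bf e0; set c := \int[mu]_x f x.
(* Subtracting [c + e / 2] makes the integral [- e / 2], so the sums of the new function stay below
   some [M], and [M / (n + 1)] is at most [e / 2] for large [n]. *)
have bg := bounded_mfunD bf (bounded_mfun_cst (- (c + e / 2))).
have := birkhoff_sums_bounded mpS eS bg.
rewrite Rintegral_bounded_mfunD_cst// -/c => /(_ _); have -> : c - (c + e / 2) < 0 by lra.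
move=> /(_ isT); apply: filterS => x [M hM].
near=> n.
rewrite /time_avg mulrC ler_pdivrMr//.
have := hM n.+1; rewrite big_split /= sumr_const card_ord -[_ *+ n.+1]mulr_natr.
have : M <= e / 2 * n.+1%:R.
  rewrite mulrC -ler_pdivrMr; last by lra.
  rewrite (le_trans (ler_norm _))// (le_trans (ltW (truncnS_gt _)))// ler_nat.
  rewrite ltnS; near: n; exact: nbhs_infty_ge.
lra.
Unshelve. all: by end_near. Qed.

(** The upper bounds for [f] and for [- f], at the countably many tolerances [1 / (m + 1)], give
    both halves of the limit off one null set. *)
Lemma time_avg_cvg S f : measure_preserving mu S -> ergodic mu S ->
  bounded_mfun f ->
  {ae mu, forall x, time_avg S f n x @[n --> \oo] --> \int[mu]_x f x}.
Proof.
move=> mpS eS bf.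
have e0 (m : nat) : (0 : R) < m.+1%:R^-1 by rewrite invr_gt0.
have H1 := ae_foralln (fun m => time_avg_limsup mpS eS bf (e0 m)).
have H2 := ae_foralln (fun m => time_avg_limsup mpS eS (bounded_mfunN bf) (e0 m)).
apply: filterS2 H1 H2 => x h1 h2; apply/cvgrPdist_le => e egt0.
pose m := Num.truncn e^-1.
have me : m.+1%:R^-1 <= e by rewrite invf_ple ?posrE// ltW// truncnS_gt.
have := h1 m; have := h2 m; apply: filterS2 => n.
rewrite /time_avg sumrN mulrN.
have -> : \int[mu]_y (- f y) = - \int[mu]_y f y.
  under eq_Rintegral do rewrite -mulN1r.
  by rewrite RintegralZl//; [rewrite mulN1r|exact: bounded_mfun_integrable].
move: me; set i := _.+1%:R^-1; set A := _ * _.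
clearbody A i; move=> me a b; rewrite ler_norml; apply/andP; split; lra.
Qed.

Lemma time_avg_bounded S f (K : R) n x : (forall x, `|f x| <= K) ->
  `|time_avg S f n x| <= K.
Proof.
move=> fK; rewrite /time_avg normrM normfV (ger0_norm (ler0n _ _)) mulrC ler_pdivrMr//.
rewrite (le_trans (ler_norm_sum _ _ _))// (le_trans (ler_sum _ (fun k _ => fK _)))//.
by rewrite sumr_const card_ord mulr_natr.
Qed.

Lemma bounded_mfun_time_avg S f n : measurable_fun [set: X] S ->
  bounded_mfun f -> bounded_mfun (time_avg S f n).
Proof.
move=> mS [mf [K fK]]; split; last by exists K => x; exact: time_avg_bounded.
apply: measurable_funM; first exact: measurable_cst.
apply: measurable_sum => k; apply: (measurableT_comp mf).
elim: (nat_of_ord k) => [|j IH] /=; first exact: measurable_id.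
exact: measurableT_comp.
Qed.

End ergodic_theorem.

(** * Covering half of the space by translates of a set *)

Section ergodic_cover.
Context d (X : measurableType d) (R : realType) (mu : probability X R).
Variable S : X -> X.
Hypotheses (mpS : measure_preserving mu S) (eS : ergodic mu S).
Local Notation P A := (fine (mu A)).

Lemma bounded_mfun_indic (A : set X) : measurable A ->
  bounded_mfun (\1_A : X -> R).
Proof.
move=> mA; split; first exact: measurable_indic.
by exists 1 => x; rewrite indicE; case: (_ \in _); rewrite ?normr1 ?normr0.
Qed.

Lemma bounded_mfunM (f g : X -> R) : bounded_mfun f -> bounded_mfun g ->
  bounded_mfun (fun x => f x * g x).
Proof.
move=> [mf [K fK]] [mg [L gL]]; split; first exact: measurable_funM.
by exists (K * L) => x; rewrite normrM ler_pM.
Qed.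

Lemma bounded_mfun_sum (f_ : nat -> X -> R) n : (forall k, bounded_mfun (f_ k)) ->
  bounded_mfun (fun x => \sum_(k < n) f_ k x).
Proof.
move=> bf; elim: n => [|n IH].
  under eq_fun do rewrite big_ord0; exact: bounded_mfun_cst.
by under eq_fun do rewrite big_ord_recr; exact: bounded_mfunD.
Qed.

Lemma Rintegral_bounded_mfun_sum (f_ : nat -> X -> R) n :
  (forall k, bounded_mfun (f_ k)) ->
  \int[mu]_x (\sum_(k < n) f_ k x) = \sum_(k < n) \int[mu]_x f_ k x.
Proof.
move=> bf; elim: n => [|n IH].
  rewrite big_ord0; under eq_Rintegral do rewrite big_ord0.
  by rewrite Rintegral_cst// mul0r.
rewrite big_ord_recr /= -IH.
transitivity (\int[mu]_x (\sum_(k < n) f_ k x + f_ n x)).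
  by apply: eq_Rintegral => x _; rewrite big_ord_recr.
rewrite RintegralD//.
- exact/bounded_mfun_integrable/bounded_mfun_sum.
- exact: bounded_mfun_integrable.
Qed.

Lemma Rintegral_indic (A : set X) : measurable A -> \int[mu]_x \1_A x = P A.
Proof. by move=> mA; rewrite /Rintegral integral_indic// setIT. Qed.

Lemma measurable_preimage_iter (E : set X) m : measurable E ->
  measurable (iter m S @^-1` E).
Proof.
move=> mE; have [mSm _] := measure_preserving_iter m mpS.
by rewrite -[_ @^-1` _]setTI; exact: mSm.
Qed.

(** By Birkhoff's theorem the averages over [m] of the measures of these intersections tend to
    [P A * P E], so the terms cannot all lie below half of it. *)
Lemma ergodic_overlap (A E : set X) : measurable A -> measurable E ->
  0 < P A -> 0 < P E ->
  exists m, P A * P E / 2 <= P (A `&` iter m S @^-1` E).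
Proof.
move=> mA mE A0 E0; apply: contrapT => /forallNP small.
have mS := mpS.1.
have bA := bounded_mfun_indic mA; have bE := bounded_mfun_indic mE.
pose g_ n x := \1_A x * time_avg S (\1_E : X -> R) n x.
have bg n : bounded_mfun (g_ n).
  by apply: bounded_mfunM => //; exact: bounded_mfun_time_avg.
have E1 y : `|(\1_E y : R)| <= 1.
  by rewrite indicE; case: (_ \in _); rewrite ?normr1 ?normr0.
have cvg_g : \int[mu]_x g_ n x @[n --> \oo] --> \int[mu]_x (\1_A x * P E).
  apply: (@bounded_mfun_Rintegral_cvg _ _ _ _ _ _ 1).
  - by move=> n; case: (bg n).
  - move=> n x; rewrite normrM -[leRHS]mulr1 ler_pM//.
      by rewrite indicE; case: (_ \in _); rewrite ?normr1 ?normr0.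
    exact: time_avg_bounded.
  - by apply: bounded_mfunM => //; exact: bounded_mfun_cst.
  - have := time_avg_cvg mpS eS bE; rewrite Rintegral_indic//.
    by apply: filterS => x h; apply: cvgM => //; exact: cvg_cst.
have gE n : \int[mu]_x g_ n x =
    n.+1%:R^-1 * \sum_(k < n.+1) P (A `&` iter k S @^-1` E).
  transitivity (\int[mu]_x (n.+1%:R^-1 *
      \sum_(k < n.+1) \1_(A `&` iter k S @^-1` E) x)).
    apply: eq_Rintegral => x _; rewrite /g_ /time_avg mulrCA; congr (_ * _).
    rewrite mulr_sumr; apply: eq_bigr => k _.
    by rewrite indicI /= !indicE.
  have bI k : bounded_mfun (\1_(A `&` iter k S @^-1` E) : X -> R).
    apply: bounded_mfun_indic; apply: measurableI => //.
    exact: measurable_preimage_iter.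
  rewrite RintegralZl//; last exact/bounded_mfun_integrable/(bounded_mfun_sum _ bI).
  rewrite (Rintegral_bounded_mfun_sum _ bI); congr (_ * _).
  apply: eq_bigr => k _; rewrite Rintegral_indic//; apply: measurableI => //.
  exact: measurable_preimage_iter.
have : \int[mu]_x (\1_A x * P E) <= P A * P E / 2.
  apply: (cvgr_to_le cvg_g); apply: nearW => n; rewrite gE mulrC ler_pdivrMr//.
  rewrite (@le_trans _ _ (\sum_(k < n.+1) P A * P E / 2))//.
    by apply: ler_sum => k _; have /negP := small k; rewrite -ltNge => /ltW.
  by rewrite sumr_const card_ord mulr_natr.
rewrite RintegralZr//; last exact: bounded_mfun_integrable.
rewrite Rintegral_indic// leNgt => /negP; apply.
by rewrite ltr_pdivrMr// ltr_pMr ?mulr_gt0// ltr1n.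
Qed.

Definition translates (E : set X) (s : seq nat) : set X :=
  [set x | exists2 m, m \in s & E (iter m S x)].

Lemma measurable_translates (E : set X) (s : seq nat) : measurable E ->
  measurable (translates E s).
Proof.
move=> mE; elim: s => [|m s IH].
  by rewrite (_ : translates _ _ = set0)//; apply/seteqP; split => // x [].
rewrite (_ : translates _ _ = iter m S @^-1` E `|` translates E s).
  by apply: measurableU => //; exact: measurable_preimage_iter.
apply/seteqP; split=> x /=.
  by move=> [k]; rewrite inE => /predU1P[->|ks Ek]; [left|right; exists k].
by case=> [Em|[k ks Ek]]; [exists m|exists k]; rewrite // inE ?eqxx ?ks ?orbT.
Qed.

(* While the translates cover less than half of [X], one more translate can be
   chosen to cover a further [mu E / 4]. *)
Lemma ergodic_cover (E : set X) : measurable E -> 0 < P E ->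
  exists s : seq nat, (size s)%:R * P E <= 3 /\ 2^-1 <= P (translates E s).
Proof.
move=> mE E0.
have fin A : measurable A -> mu A = (P A)%:E.
  by move=> mA; rewrite fineK// fin_num_measure.
have greedy H : exists s : seq nat, size s = H /\
    Num.min 2^-1 (H%:R * P E / 4) <= P (translates E s).
  elim: H => [|H [s [sH IH]]].
    by exists [::]; split=> //; rewrite ge_min mul0r mul0r fine_ge0 ?orbT.
  have mU := measurable_translates s mE; set U := translates E s in IH mU.
  have [U2|U2] := leP 2^-1 (P U).
    (* The cover is already large enough; the index 0 only pads the list to length [H + 1]. *)
    exists (0%N :: s); split=> /=; first by rewrite sH.
    rewrite ge_min (le_trans U2)// fine_le ?fin_num_measure//.
    - exact: measurable_translates.
    - apply: le_measure; rewrite ?inE//; first exact: measurable_translates.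
      by move=> x [k ks Ek]; exists k => //; rewrite inE ks orbT.
  have UC : P (~` U) = 1 - P U.
    by rewrite probability_setC// fineB ?fin_num_measure.
  have UC0 : 0 < P (~` U) by rewrite UC; lra.
  have [m hm] := ergodic_overlap (measurableC mU) mE UC0 E0.
  exists (m :: s); split=> /=; first by rewrite sH.
  have mI : measurable (~` U `&` iter m S @^-1` E).
    by apply: measurableI; [exact: measurableC|exact: measurable_preimage_iter].
  have : P U + P (~` U `&` iter m S @^-1` E) <= P (translates E (m :: s)).
    rewrite -lee_fin EFinD -!fin//; last exact: measurable_translates.
    rewrite -measureU//; last by rewrite setIA setICr set0I.
    apply: le_measure; rewrite ?inE//; [exact: measurableU|exact: measurable_translates|].
    move=> x [[k ks Ek]|[_ Em]]; last by exists m => //; rewrite inE eqxx.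
    by exists k => //; rewrite inE ks orbT.
  have h : P E / 4 <= P (~` U) * P E / 2.
    by rewrite UC; nra.
  have IH' : H%:R * P E / 4 <= P U.
    by move: IH; rewrite ge_min leNgt U2.
  move=> le_new; rewrite ge_min; apply/orP; right.
  by rewrite -natr1; lra.
(* This [H] puts [H * P E] between 2 and 3: the lower bound turns the greedy estimate into one half,
   and the upper bound uses [P E <= 1]. *)
pose H := (Num.truncn (2 / P E)).+1.
have H2 : 2 <= H%:R * P E by rewrite -ler_pdivrMr// ltW// truncnS_gt.
have H3 : H%:R * P E <= 3.
  have : (Num.truncn (2 / P E))%:R * P E <= 2.
    by rewrite -ler_pdivlMr// truncn_le// divr_ge0// ltW.
  have : P E <= 1.
    by rewrite -lee_fin -fin// probability_le1.
  by rewrite /H -natr1; lra.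
have [s [sH sP]] := greedy H; exists s; rewrite sH; split=> //.
by rewrite (le_trans _ sP)// le_min lexx/= ; lra.
Qed.

End ergodic_cover.

(** * Moments of order [p], that is, [p]-th powers of norms *)

Section pth_moment.
Context d (X : measurableType d) (R : realType) (mu : probability X R).
Variables (p : R) (p1 : 1 <= p).

Definition moment (f : X -> R) : \bar R := (\int[mu]_x (`|f x| `^ p)%:E)%E.

Let p_gt0 : 0 < p. Proof. exact: lt_le_trans p1. Qed.
Let p0 : p != 0. Proof. exact: lt0r_neq0. Qed.

Lemma momentE f : moment f = ('N[mu]_(p%:E)[EFin \o f] `^ p)%E.
Proof. by rewrite powR_Lnorm. Qed.

Lemma Lfun_momentP f : f \in Lfun mu p%:E <->
  measurable_fun [set: X] f /\ (moment f < +oo)%E.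
Proof.
rewrite inE; split.
  move=> /andP[/[!inE]/= mf ff]; split => //.
  by rewrite momentE poweR_lty.
move=> [mf ff]; apply/andP; split; rewrite inE//=.
by rewrite /finite_norm unlock; exact: poweR_lty.
Qed.

(** This puts the right side of the weak type inequality in a form linear in the moment; the norm is
    finite, so [fine] loses nothing. *)
Lemma weak_type_bound (C l : R) f : 0 < l -> f \in Lfun mu p%:E ->
  (C * (fine ('N[mu]_(p%:E)[EFin \o f]) / l) `^ p)%:E =
  ((C * l^-1 `^ p)%:E * moment f)%E.
Proof.
move=> l0; rewrite inE => /andP[_ /[!inE]/= ff]; rewrite /finite_norm in ff.
have N0 := Lnorm_ge0 mu p%:E (EFin \o f).
rewrite momentE -[X in (_ * X `^ _)%E]fineK ?ge0_fin_numE//.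
rewrite poweR_EFin -EFinM -mulrA [_ `^ p * _]mulrC -powRM ?fine_ge0// invr_ge0.
exact: ltW.
Qed.

Lemma measurable_powR_norm (f : X -> R) : measurable_fun [set: X] f ->
  measurable_fun [set: X] (fun x => (`|f x| `^ p)%:E).
Proof.
move=> mf; apply/measurable_EFinP.
apply: (measurableT_comp (measurable_powR _)) => //; exact: measurableT_comp.
Qed.

Lemma moment_ge0 (f : X -> R) : (0 <= moment f)%E.
Proof. by apply: integral_ge0 => x _; rewrite lee_fin powR_ge0. Qed.

Lemma momentZ (c : R) (f : X -> R) : 0 <= c -> measurable_fun [set: X] f ->
  moment (fun x => c * f x) = ((c `^ p)%:E * moment f)%E.
Proof.
move=> c0 mf; rewrite /moment -ge0_integralZl//.
- by apply: eq_integral => x _; rewrite normrM powRM// ger0_norm// EFinM.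
- exact: measurable_powR_norm.
- by rewrite lee_fin powR_ge0.
Qed.

Lemma moment_norm (f : X -> R) : moment (fun x => `|f x|) = moment f.
Proof. by apply: eq_integral => x _; rewrite normr_id. Qed.

Lemma powR_norm_cvg0 (u : nat -> R) : u n @[n --> \oo] --> (0 : R) ->
  (`|u n| `^ p : R) @[n --> \oo] --> (0 : R).
Proof.
move=> /cvgrPdist_le u0; apply/cvgrPdist_le => e e0.
(* The tolerance is capped at 1 because raising a number of [[0, 1]] to a power [p >= 1] does not
   increase it. *)
have m0 : 0 < Num.min 1 e by rewrite lt_min ltr01.
have := u0 _ m0; apply: filterS => n; rewrite !sub0r !normrN le_min => /andP[u1 ue].
rewrite ger0_norm ?powR_ge0// (le_trans _ ue)//.
have [->|un0] := eqVneq (u n) 0; first by rewrite normr0 powR0 ?lt0r_neq0.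
by rewrite ge1r_powR// normr_gt0 un0.
Qed.

Lemma moment_cvg0 (h_ : nat -> X -> R) (G : X -> R) : G \in Lfun mu p%:E ->
  (forall n, measurable_fun [set: X] (h_ n)) ->
  (forall n x, `|h_ n x| <= `|G x|) ->
  {ae mu, forall x, h_ n x @[n --> \oo] --> (0 : R)} ->
  moment (h_ n) @[n --> \oo] --> 0%E.
Proof.
move=> GL mh hG ah.
have [] := @dominated_convergence _ _ _ mu setT measurableT
  (fun n x => (`|h_ n x| `^ p)%:E) (cst 0%E) (fun x => (`|G x| `^ p)%:E).
- by move=> n; exact: measurable_powR_norm.
- exact: measurable_cst.
- apply: filterS ah => x hx _; apply: cvg_EFin; first exact: nearW.
  exact: powR_norm_cvg0.
- exact: Lfun_integrable.
- apply: aeW => x n _; rewrite gee0_abs ?lee_fin ?powR_ge0//.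
  by rewrite ge0_ler_powR ?nnegrE ?(ltW p_gt0).
- by move=> _ _; rewrite integral0.
Qed.

(** The sum is at most twice the larger term. This takes the place of Minkowski's inequality, at the
    price of a harmless constant. *)
Lemma powR_normD_le (a b : R) :
  `|a + b| `^ p <= 2 `^ p * (`|a| `^ p + `|b| `^ p).
Proof.
have pge0 := ltW p_gt0; wlog ba : a b / `|b| <= `|a|.
  move=> H; have [/H//|/ltW/H] := leP `|b| `|a|.
  by rewrite (addrC b) (addrC (`|b| `^ p)).
rewrite (@le_trans _ _ ((2 * `|a|) `^ p))//.
  rewrite ge0_ler_powR ?nnegrE ?mulr_ge0// (le_trans (ler_normD _ _))//.
  by rewrite mulr_natl mulr2n lerD2l.
by rewrite powRM// ler_wpM2l ?powR_ge0// lerDl powR_ge0.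
Qed.

Lemma momentD_le (f g : X -> R) :
  measurable_fun [set: X] f -> measurable_fun [set: X] g ->
  (moment (fun x => f x + g x)%R <= (2 `^ p)%:E * (moment f + moment g))%E.
Proof.
move=> mf mg; have mpf := measurable_powR_norm mf.
have mpg := measurable_powR_norm mg.
rewrite /moment -ge0_integralD//; [|by move=> x _; rewrite lee_fin powR_ge0..].
rewrite -ge0_integralZl//; last 2 first.
- exact: emeasurable_funD.
- by move=> x _; rewrite adde_ge0 ?lee_fin ?powR_ge0.
apply: ge0_le_integral => //.
- by apply: measurable_powR_norm; exact: measurable_funD.
- by apply: emeasurable_funM; [exact: measurable_cst|exact: emeasurable_funD].
- by move=> x _; rewrite -EFinD -EFinM lee_fin powR_normD_le.
Qed.

End pth_moment.

(** * Averages over lattice points *)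

Section averages_theory.
Context d (X : measurableType d) (R : realType) (mu : probability X R).
Variables (S T : invertible_mpt mu).
Hypothesis commST : forall x, S (T x) = T (S x).

Lemma iter_comm (f g : X -> X) (n : nat) (x : X) :
  (forall y, f (g y) = g (f y)) -> f (iter n g x) = iter n g (f x).
Proof. by move=> fg; elim: n => //= n IH; rewrite fg IH. Qed.

(** A map that commutes with [U] also commutes with its inverse, which settles the negative
    powers. *)
Lemma mpt_iter_comm (U : invertible_mpt mu) (f : X -> X) (i : int) (x : X) :
  (forall y, f (U y) = U (f y)) -> f (mpt_iter U i x) = mpt_iter U i (f x).
Proof.
move=> fU; case: i => n; apply: (@iter_comm f _ _ x) => // y.
by apply: (can_inj (@mpt_funK _ _ _ _ U)); rewrite mpt_invK -fU mpt_invK.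
Qed.

Lemma mpt_iterS (U : invertible_mpt mu) (i : int) (x : X) :
  mpt_iter U (i + 1) x = U (mpt_iter U i x).
Proof.
case: i => [n|[|n]] /=; first by rewrite addn1.
  by rewrite mpt_invK.
by rewrite mpt_invK subn1.
Qed.

Lemma mpt_iter_mp (U : invertible_mpt mu) (i : int) :
  measure_preserving mu (mpt_iter U i).
Proof.
case: i => n; apply: measure_preserving_iter; [exact: mpt_fun_mp|exact: mpt_inv_mp].
Qed.

Definition lattice_act (z : int * int) (x : X) : X := mpt_iter S z.1 (mpt_iter T z.2 x).

(** Since [S] and [T] commute, powers of [S] commute with the whole action; averages can then be
    transported along translates in Sawyer's argument. *)
Lemma lattice_act_iter (z : int * int) (m : nat) (x : X) :
  lattice_act z (iter m S x) = iter m S (lattice_act z x).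
Proof.
rewrite /lattice_act -(@mpt_iter_comm T (iter m S)); last first.
  by move=> y; rewrite (@iter_comm T S m)// => w; exact/esym.
by rewrite -(@mpt_iter_comm S (iter m S))// => y; rewrite -iterS iterSr.
Qed.

Lemma measurable_lattice_act (z : int * int) : measurable_fun [set: X] (lattice_act z).
Proof.
have [mS _] := mpt_iter_mp S z.1; have [mT _] := mpt_iter_mp T z.2.
exact: measurableT_comp mS mT.
Qed.

Lemma negligible_lattice_act (z : int * int) (A : set X) : mu.-negligible A ->
  mu.-negligible (lattice_act z @^-1` A).
Proof.
have [mS hS] := mpt_iter_mp S z.1; have [mT hT] := mpt_iter_mp T z.2.
move=> [B [mB B0 AB]]; exists (lattice_act z @^-1` B); split.
- by rewrite -[_ @^-1` _]setTI; exact: measurable_lattice_act.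
- rewrite -[_ @^-1` _]/(mpt_iter T z.2 @^-1` (mpt_iter S z.1 @^-1` B)) hT ?hS//.
  by rewrite -[_ @^-1` _]setTI; exact: mS.
- by move=> x; exact: AB.
Qed.

Variable Rn : nat -> rectangle R.
Local Notation M := (ergodic_avg S T Rn).
Local Notation L n := (fset_set (lattice_pts (Rn n))).
Implicit Types f g : X -> R.

Lemma ergodic_avgE n f x :
  M n f x = #|` L n|%:R^-1 * \sum_(z <- L n) f (lattice_act z x).
Proof. by rewrite /ergodic_avg fsbig_finite//; exact: finite_lattice_pts. Qed.

Lemma ergodic_avgD n f g x : M n (fun y => f y + g y) x = M n f x + M n g x.
Proof. by rewrite !ergodic_avgE big_split mulrDr. Qed.

Lemma ergodic_avgZ n (c : R) f x : M n (fun y => c * f y) x = c * M n f x.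
Proof. by rewrite !ergodic_avgE -mulr_sumr mulrCA. Qed.

Lemma ergodic_avg_sum n I (s : seq I) (f : I -> X -> R) x :
  M n (fun y => \sum_(i <- s) f i y) x = \sum_(i <- s) M n (f i) x.
Proof.
rewrite ergodic_avgE exchange_big mulr_sumr.
by apply: eq_bigr => i _; rewrite ergodic_avgE.
Qed.

Lemma ergodic_avg_iter n f m x : M n (fun y => f (iter m S y)) x = M n f (iter m S x).
Proof. by rewrite !ergodic_avgE; under eq_bigr do rewrite -lattice_act_iter. Qed.

Lemma ergodic_avg_le n f g x : (forall z, f (lattice_act z x) <= g (lattice_act z x)) ->
  M n f x <= M n g x.
Proof.
move=> fg; rewrite !ergodic_avgE ler_wpM2l ?invr_ge0//.
by apply: ler_sum => z _; exact: fg.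
Qed.

Lemma ergodic_avg_norm n f x : `|M n f x| <= M n (fun y => `|f y|) x.
Proof.
rewrite !ergodic_avgE normrM ger0_norm ?invr_ge0// ler_wpM2l ?invr_ge0//.
exact: ler_norm_sum.
Qed.

Lemma measurable_ergodic_avg n f : measurable_fun [set: X] f ->
  measurable_fun [set: X] (M n f).
Proof.
move=> mf; rewrite (_ : M n f =
  fun x => #|` L n|%:R^-1 * \sum_(z <- L n) f (lattice_act z x)); last first.
  by apply/funext => x; rewrite ergodic_avgE.
apply: measurable_funM; first exact: measurable_cst.
by apply: measurable_sum => z; exact: (measurableT_comp mf (measurable_lattice_act z)).
Qed.

Lemma maximal_op_gtP f (l : R) x :
  (l%:E < maximal_op S T Rn f x)%E <-> exists n, l < M n (fun y => `|f y|) x.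
Proof.
split=> [/ereal_sup_gt[_ [n _ <-]]|[n h]]; first by rewrite lte_fin; exists n.
apply: (@lt_le_trans _ _ (M n (fun y => `|f y|) x)%:E); first by rewrite lte_fin.
by apply: ereal_sup_ubound; exists n.
Qed.

Lemma measurable_maximal_op_gt f (l : R) : measurable_fun [set: X] f ->
  measurable [set x | (l%:E < maximal_op S T Rn f x)%E].
Proof.
move=> mf; rewrite (_ : mkset _ = \bigcup_n
    ([set: X] `&` M n (fun y => `|f y|) @^-1` [set` `]l, +oo[])).
  apply: bigcupT_measurable => n; apply: measurable_ergodic_avg => //.
    exact: measurableT_comp.
apply/seteqP; split => x /=.
  by move=> /maximal_op_gtP[n h]; exists n => //; split => //=; rewrite in_itv/= h.
by move=> [n _ [_ /=]]; rewrite in_itv/= andbT => h; apply/maximal_op_gtP; exists n.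
Qed.

Hypothesis processRn : is_process Rn.

Lemma ergodic_avg_cst n (c : R) x : M n (fun=> c) x = c.
Proof.
rewrite ergodic_avgE big_const_seq count_predT iter_addr addr0.
rewrite -[c *+ _]mulr_natl mulKf// pnatr_eq0 cardfs_eq0.
(* The origin lies in every rectangle of a process, so the number of lattice points is not 0. *)
apply/eqP => /fsetP/(_ (0, 0)); rewrite in_fset_set; last exact: finite_lattice_pts.
by rewrite inE => /negP; apply; apply/mem_set/processRn.1.
Qed.

(** Composing with [S] moves the lattice points one step along their rows, which is negligible by
    [process_row_shift]; [k] steps telescope. *)
Lemma ergodic_avg_shift_cvg f (K : R) (k : nat) x : (forall y, `|f y| <= K) ->
  (M n f x - M n (fun y => f (iter k S y)) x : R) @[n --> \oo] --> (0 : R).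
Proof.
move=> fK; elim: k => [|k IH].
  by apply: cvg_near_cst; apply: nearW => n /=; rewrite subrr.
suff H : (M n (fun y => f (iter k S y)) x - M n (fun y => f (iter k.+1 S y)) x : R)
    @[n --> \oo] --> (0 : R).
  have IHH := cvgD IH H; rewrite addr0 in IHH.
  apply: (cvg_trans _ (IHH _)); apply: near_eq_cvg.
  by apply: nearW => n /=; rewrite addrA subrK.
have K0 : 0 <= K by rewrite (le_trans _ (fK x)).
(* The bound [K] may be 0, so [K + 1] is used in order to divide [e] by it. *)
apply/cvgrPdist_le => e e0; have K1 : 0 < K + 1 by lra.
have eK : 0 < e / (K + 1) by rewrite divr_gt0.
have := process_row_shift processRn eK; apply: filterS => n h.
have H z : `|f (iter k S (lattice_act z x))| <= K + 1.
  by rewrite (le_trans (fK _))// lerDl.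
have {h} := h (K + 1) (fun z => f (iter k S (lattice_act z x))) H.
have eqS z : f (iter k S (lattice_act (z.1 + 1, z.2) x)) =
    f (iter k.+1 S (lattice_act z x)).
  by rewrite /lattice_act mpt_iterS -iterSr.
under eq_bigr do rewrite eqS.
rewrite divfK ?lt0r_neq0// sub0r normrN !ergodic_avgE.
rewrite -mulrBr normrM ger0_norm ?invr_ge0// distrC.
move=> h; have [->|c0] := eqVneq (#|` L n|%:R : R) 0.
  by rewrite invr0 mul0r ltW.
by rewrite mulrC ler_pdivrMr// lt0r c0 ler0n.
Qed.

(** The difference is the mean over [k <= N] of the differences produced by [k] shifts, each of
    which tends to 0. *)
Lemma ergodic_avg_time_avg_cvg f (K : R) (N : nat) x : (forall y, `|f y| <= K) ->
  (M n f x - M n (time_avg S f N) x : R) @[n --> \oo] --> (0 : R).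
Proof.
move=> fK.
have : (N.+1%:R^-1 * \sum_(k < N.+1) (M n f x - M n (fun y => f (iter k S y)) x) : R)
    @[n --> \oo] --> N.+1%:R^-1 * \sum_(k < N.+1) (0 : R).
  apply: cvgM; first exact: cvg_cst.
  by apply: (cvg_big add_continuous) => k _; exact: ergodic_avg_shift_cvg fK.
rewrite big1// mulr0 => H.
apply: (cvg_trans _ H); apply: near_eq_cvg; apply: nearW => n.
rewrite sumrB sumr_const card_ord mulrBr -[M n f x *+ _]mulr_natl mulKf ?pnatr_eq0//.
by rewrite /time_avg ergodic_avgZ ergodic_avg_sum.
Qed.

End averages_theory.

(** * Sawyer's theorem *)

Section sawyer.
Context d (X : measurableType d) (R : realType) (mu : probability X R).
Variables (S T : invertible_mpt mu).
Hypotheses (ergS : ergodic mu S) (commST : forall x, S (T x) = T (S x)).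
Variables (Rn : nat -> rectangle R) (p : R).
Hypothesis p_ge1 : 1 <= p.
Local Notation M := (ergodic_avg S T Rn).
Local Notation Mmax := (maximal_op S T Rn).
Local Notation moment := (moment mu p).

Let p_gt0 : 0 < p. Proof. exact: lt_le_trans p_ge1. Qed.

Lemma moment_iter (f : X -> R) m : measurable_fun [set: X] f ->
  moment (fun x => f (iter m S x)) = moment f.
Proof.
move=> mf; have mpS := measure_preserving_iter m (mpt_fun_mp S).
apply: (ge0_integral_measure_preserving (f := fun x => (`|f x| `^ p)%:E) mpS).
  exact: measurable_powR_norm.
by move=> x; rewrite lee_fin powR_ge0.
Qed.

(** Failure of the inequality with constant [C] gives some [f] and [l]; passing to [|f| / l]
    normalises the level to 1. *)
Lemma not_weak_type_witness (C : R) : 0 < C -> ~ weak_type mu p Mmax ->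
  exists g : X -> R, [/\ measurable_fun [set: X] g, forall x, 0 <= g x,
    (moment g < +oo)%E & (C%:E * moment g < mu [set x | 1 < Mmax g x])%E].
Proof.
move=> C0 nW; apply: contrapT => nex; apply: nW; exists C => // f fL l l0.
have [mf ff] := (Lfun_momentP mu p_ge1 f).1 fL.
rewrite weak_type_bound// leNgt; apply/negP => h; apply: nex.
have l1 : 0 <= l^-1 by rewrite invr_ge0 ltW.
have mnf : measurable_fun [set: X] (fun x => `|f x|) by exact: measurableT_comp.
pose g x := l^-1 * `|f x|; have g0 x : 0 <= g x by rewrite mulr_ge0.
have momE : moment g = ((l^-1 `^ p)%:E * moment f)%E.
  by rewrite momentZ// moment_norm.
have MgE n x : (1 < M n (fun y => `|g y|) x) = (l < M n (fun y => `|f y|) x).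
  rewrite (_ : (fun y => _) = g); last by apply/funext => y; rewrite ger0_norm.
  by rewrite ergodic_avgZ mulrC ltr_pdivlMr// mul1r.
exists g; split => //.
- by apply: measurable_funM => //; exact: measurable_cst.
- by rewrite momE lte_mul_pinfty ?lee_fin ?powR_ge0.
- rewrite momE muleA -EFinM (_ : [set x | _] = [set x | (l%:E < Mmax f x)%E])//.
  by apply/seteqP; split => x /= /maximal_op_gtP[n hn]; apply/maximal_op_gtP;
    exists n; [rewrite -MgE|rewrite MgE].
Qed.

(** * One function dominating all the chosen translates *)

Section gliding_series.
Variables (g : nat -> X -> R) (s : nat -> seq nat).
Hypotheses (mg : forall k, measurable_fun [set: X] (g k))
  (g0 : forall k x, 0 <= g k x).

Definition gliding_term (k m : nat) (x : X) : \bar R :=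
  ((k.+1%:R * g k (iter m S x)) `^ p)%:E.

(** A [p]-sum dominates each of its terms and integrates term by term. The factor [k + 1] in the
    terms is what will make the averages unbounded. *)
Definition gliding_series (x : X) : \bar R :=
  (\sum_(k <oo) \sum_(m <- s k) gliding_term k m x)%E.

Lemma gliding_term_ge0 k m x : (0 <= gliding_term k m x)%E.
Proof. by rewrite lee_fin powR_ge0. Qed.

Lemma gliding_sum_ge0 k x : (0 <= \sum_(m <- s k) gliding_term k m x)%E.
Proof. by apply: sume_ge0 => m _; exact: gliding_term_ge0. Qed.

Lemma gliding_series_ge0 x : (0 <= gliding_series x)%E.
Proof. by apply: nneseries_ge0 => k _ _; exact: gliding_sum_ge0. Qed.

Lemma measurable_shifted k m :
  measurable_fun [set: X] (fun x => k.+1%:R * g k (iter m S x)).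
Proof.
have [mS _] := measure_preserving_iter m (mpt_fun_mp S).
apply: measurable_funM; first exact: measurable_cst.
exact: measurableT_comp (mg k) mS.
Qed.

Lemma measurable_gliding_term k m : measurable_fun [set: X] (gliding_term k m).
Proof.
apply/measurable_EFinP; apply: (measurableT_comp (measurable_powR _)).
exact: measurable_shifted.
Qed.

Lemma measurable_gliding_series : measurable_fun [set: X] gliding_series.
Proof.
apply: (ge0_emeasurable_sum (P := xpredT)).
  by move=> k x _ _; exact: gliding_sum_ge0.
by move=> k _; apply: emeasurable_sum => m; exact: measurable_gliding_term.
Qed.

Lemma integral_gliding_term k m :
  (\int[mu]_x gliding_term k m x = (k.+1%:R `^ p)%:E * moment (g k))%E.
Proof.
rewrite -(moment_iter m (mg k)) -momentZ//; last first.
  have [mS _] := measure_preserving_iter m (mpt_fun_mp S).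
  exact: measurableT_comp (mg k) mS.
by apply: eq_integral => x _; rewrite ger0_norm// mulr_ge0.
Qed.

Lemma integral_gliding_series :
  (\int[mu]_x gliding_series x =
   \sum_(k <oo) (size (s k))%:R%:E * ((k.+1%:R `^ p)%:E * moment (g k)))%E.
Proof.
rewrite integral_nneseries//; last 2 first.
- by move=> k; apply: emeasurable_sum => m; exact: measurable_gliding_term.
- by move=> k x _; exact: gliding_sum_ge0.
apply: eq_eseriesr => k _; rewrite ge0_integral_sum//; last 2 first.
- by move=> m; exact: measurable_gliding_term.
- by move=> m x _; exact: gliding_term_ge0.
under eq_bigr do rewrite integral_gliding_term.
elim: (s k) => [|m t IH]; first by rewrite big_nil mul0e.
by rewrite big_cons IH /= -[(size t).+1%:R]natr1 EFinD ge0_muleDl ?lee_fin// mul1e addeC.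
Qed.

(** Where the series is infinite, [fine] makes this function 0, so it dominates the individual terms
    only where the series is finite. *)
Definition gliding_fun (x : X) : R := fine (gliding_series x) `^ p^-1.

Lemma measurable_gliding_fun : measurable_fun [set: X] gliding_fun.
Proof.
apply: (measurableT_comp (measurable_powR _)).
exact: measurableT_comp (fine_measurable measurableT) measurable_gliding_series.
Qed.

Lemma moment_gliding_fun : (moment gliding_fun <= \int[mu]_x gliding_series x)%E.
Proof.
apply: ge0_le_integral => //.
- exact/measurable_powR_norm/measurable_gliding_fun.
- exact: measurable_gliding_series.
- move=> x _; rewrite ger0_norm ?powR_ge0// -powRrM mulVf ?gt_eqF// powRr1.
    by case: (gliding_series x) (gliding_series_ge0 x) => [r| |] //= _; rewrite leey.
  by rewrite fine_ge0// gliding_series_ge0.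
Qed.

Lemma gliding_fun_ge k m x : (gliding_series x < +oo)%E -> m \in s k ->
  k.+1%:R * g k (iter m S x) <= gliding_fun x.
Proof.
move=> fin ms.
have h : (gliding_term k m x <= gliding_series x)%E.
  apply: (@le_trans _ _ (\sum_(0 <= j < k.+1) \sum_(m <- s j) gliding_term j m x)%E).
    rewrite big_nat_recr//= (big_rem m ms)/= addeCA leeDl//.
    by rewrite adde_ge0// sume_ge0// => j _;
      [exact: gliding_sum_ge0|exact: gliding_term_ge0].
  by apply: nneseries_lim_ge => j _ _; exact: gliding_sum_ge0.
have a0 : 0 <= k.+1%:R * g k (iter m S x) by rewrite mulr_ge0.
have <- : ((k.+1%:R * g k (iter m S x)) `^ p) `^ p^-1 = k.+1%:R * g k (iter m S x).
  by rewrite -powRrM divff ?lt0r_neq0// powRr1.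
have S0 := gliding_series_ge0 x.
apply: ge0_ler_powR; rewrite ?nnegrE ?powR_ge0 ?invr_ge0 ?fine_ge0 ?(ltW p_gt0)//.
by rewrite -lee_fin fineK// ge0_fin_numE.
Qed.

End gliding_series.

(** The lattice is countable: enumerating it by [pickle] puts the exceptional points of all the maps
    [lattice_act S T z] in one null set. *)
Lemma ae_lattice_act (P : X -> Prop) : {ae mu, forall x, P x} ->
  {ae mu, forall x, forall z, P (lattice_act S T z x)}.
Proof.
move=> aP; have := @ae_foralln _ _ _ mu
  (fun k x => forall z : int * int, choice.unpickle k = Some z ->
    P (lattice_act S T z x)).
move=> H; apply: filterS (H _) => [x h z|k].
  exact: (h (choice.pickle z) z (choice.pickleK z)).
case Ek : (choice.unpickle k) => [z|]; last exact: aeW.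
rewrite /= in Ek.
apply: negligibleS (negligible_lattice_act S T z aP) => x /=; apply: contra_not => h z'.
by move=> [<-].
Qed.

(** The hypothesis asks only that averages of nonnegative functions be bounded above almost
    everywhere, which is all that the contradiction uses. *)
Lemma maximal_weak_type :
  (forall F : X -> R, F \in Lfun mu p%:E -> (forall x, 0 <= F x) ->
     {ae mu, forall x, exists B : R, forall n, M n F x <= B}) ->
  weak_type mu p Mmax.
Proof.
move=> bndF; apply: contrapT => nW.
(* The 3 matches the cover bound of [ergodic_cover], the power of [k + 1] the weight in
   [gliding_term], and the power of 2 makes the series of moments summable. *)
pose C k : R := 3 * (k.+1%:R `^ p) * (2 ^ k.+1)%:R.
have C0 k : 0 < C k by rewrite !mulr_gt0// ?powR_gt0// ltr0n expn_gt0.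
have /choice[g gP] k := not_weak_type_witness (C0 k) nW.
have mg k : measurable_fun [set: X] (g k) by case: (gP k).
have g0 k x : 0 <= g k x by case: (gP k).
pose E k := [set x | (1 < Mmax (g k) x)%E].
have mE k : measurable (E k) by exact: measurable_maximal_op_gt.
have finE k : mu (E k) = (fine (mu (E k)))%:E by rewrite fineK// fin_num_measure.
have finm k : moment (g k) = (fine (moment (g k)))%:E.
  by rewrite fineK// ge0_fin_numE ?moment_ge0//; case: (gP k).
have gE k : C k * fine (moment (g k)) < fine (mu (E k)).
  by rewrite -lte_fin EFinM -finE -finm; case: (gP k).
have m0 k : 0 <= fine (moment (g k)) by rewrite fine_ge0// moment_ge0.
have E0 k : 0 < fine (mu (E k)).
  by rewrite (le_lt_trans _ (gE k))// mulr_ge0// ltW.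
have /choice[s sP] k := ergodic_cover (mpt_fun_mp S) ergS (mE k) (E0 k).
have size_bound (q r h e a : R) : 0 < q -> 0 < r -> 0 <= h -> 0 <= a ->
    h * e <= 3 -> 3 * r * q * a < e -> h * (r * a) <= 1 / q.
  move=> q0 r0 h0 a0 he /ltW/(ler_wpM2l h0) hae.
  by rewrite ler_pdivlMr//; lra.
have int_fin : (\int[mu]_x gliding_series g s x < +oo)%E.
  rewrite integral_gliding_series//.
  apply: (@le_lt_trans _ _ 1%:E); last exact: ltry.
  (* The [k]-th term will be at most [1 / 2 ^ (k + 1)], and these sum to at most 1. *)
  apply: le_trans (epsilon_trick0 xpredT ler01).
  apply: lee_nneseries => k _.
    by move=> _; rewrite !mule_ge0 ?lee_fin ?powR_ge0 ?moment_ge0.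
  rewrite finm -!EFinM lee_fin; have [s3 _] := sP k.
  by apply: size_bound s3 (gE k).
have mPhi := measurable_gliding_series s mg.
have FL : gliding_fun g s \in Lfun mu p%:E.
  apply/Lfun_momentP => //; split; first exact: measurable_gliding_fun.
  exact: le_lt_trans (moment_gliding_fun s mg) int_fin.
have ae_fin : {ae mu, forall x, (gliding_series g s x < +oo)%E}.
  have iPhi : mu.-integrable [set: X] (gliding_series g s).
    apply/integrableP; split => //.
    by under eq_integral do rewrite gee0_abs ?gliding_series_ge0//.
  apply: filterS (integrable_ae measurableT iPhi) => x /(_ I).
  by rewrite ge0_fin_numE ?gliding_series_ge0.
pose G k := translates S (E k) (s k).
have mG k : measurable (G k) by apply: measurable_translates => //; exact: mpt_fun_mp.
have mlimG : measurable (lim_sup_set G).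
  by apply: bigcapT_measurable => n; exact: bigcup_measurable.
have G_half n : ((2^-1)%:E <= mu (\bigcup_(k >= n) G k))%E.
  apply: (@le_trans _ _ (mu (G n))).
    have [_] := sP n; rewrite -/(G n) -lee_fin fineK//.
    by rewrite fin_num_measure.
  apply: le_measure; rewrite ?inE//; first exact: bigcup_measurable.
  by move=> x Gx; exists n => //=.
(* Continuity from above along the decreasing tails, each of measure at least one half. *)
have limG_half : ((2^-1)%:E <= mu (lim_sup_set G))%E.
  apply: (cvge_to_ge (lim_sup_set_cvg mu G mG _)); last exact: nearW.
  by rewrite -ge0_fin_numE ?fin_num_measure//; exact: bigcup_measurable.
have aeNG : {ae mu, forall x, ~ lim_sup_set G x}.
  (* The series must be finite along the whole orbit of [x], since the comparison with [F] is made
     at every lattice point. *)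
  apply: filterS2 (ae_lattice_act ae_fin) (bndF _ FL (fun x => powR_ge0 _ _)).
  move=> x Phi_fin [B hB] Gx.
  (* Some [k] with [k + 1 > B] and [m] in [s k] put [iter m S x] in [E k]. An average of [g k]
     exceeds 1 there, so the corresponding average of [F] at [x] exceeds [k + 1], against the bound
     [B]. *)
  have [k /= kB [m ms /maximal_op_gtP[n]]] := Gx (Num.truncn B) I.
  rewrite ltNge => /negP; apply.
  have kB' : B < k.+1%:R.
    by rewrite (lt_le_trans (truncnS_gt B))// ler_nat ltnS.
  rewrite -(@ler_pM2l _ k.+1%:R)// mulr1 (le_trans _ (ltW kB'))// (le_trans _ (hB n))//.
  rewrite -ergodic_avg_iter// -ergodic_avgZ; apply: ergodic_avg_le => z.
  by rewrite ger0_norm//; exact: gliding_fun_ge.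
have /(measure_negligible mlimG) G0 : mu.-negligible (lim_sup_set G).
  by apply: negligibleS aeNG => x Gx /=; exact.
move: limG_half; rewrite G0 lee_fin.
by rewrite leNgt invr_gt0 ltr0n.
Qed.

End sawyer.

(** * The Banach principle *)

Lemma cvge0_exists_le (R : realType) (u : nat -> \bar R) (e : R) :
  u n @[n --> \oo] --> 0%E -> 0 < e -> exists n, (u n <= e%:E)%E.
Proof.
move=> /fine_cvgP[finu /cvgrPdist_le u0] e0; have := u0 _ e0.
move=> /(filterS2 _ (fun n fn un => conj fn un) finu)[n _ /(_ n (leqnn n))[fn]].
rewrite sub0r normrN => un; exists n; rewrite -(fineK fn) lee_fin.
exact: le_trans (ler_norm _) un.
Qed.

Section banach_principle.
Context d (X : measurableType d) (R : realType) (mu : probability X R).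
Variables (S T : invertible_mpt mu).
Hypotheses (ergS : ergodic mu S) (commST : forall x, S (T x) = T (S x)).
Variables (Rn : nat -> rectangle R) (p : R).
Hypotheses (processRn : is_process Rn) (p_ge1 : 1 <= p).
Local Notation M := (ergodic_avg S T Rn).
Local Notation Mmax := (maximal_op S T Rn).
Local Notation moment := (moment mu p).

(** Replacing [f] by 0 where [|f| > n] leaves an error dominated by [|f|] that vanishes at each
    point for large [n]. *)
Lemma truncation_approx (f : X -> R) (e : R) : 0 < e -> f \in Lfun mu p%:E ->
  exists2 g, bounded_mfun g & (moment (fun x => f x - g x)%R <= e%:E)%E.
Proof.
move=> e0 fL; have [mf _] := (Lfun_momentP mu p_ge1 f).1 fL.
pose A n := [set x | `|f x| <= n%:R].
have mA n : measurable (A n).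
  rewrite (_ : A n = [set: X] `&` (fun x => `|f x|) @^-1` [set` `]-oo, n%:R]]).
    have mnf : measurable_fun [set: X] (fun x => `|f x|) by exact: measurableT_comp.
    by apply: mnf => //; exact: measurable_itv.
  by apply/seteqP; split => x /=; rewrite in_itv/= // => -[].
pose g n x := f x * \1_(A n) x.
have bg n : bounded_mfun (g n).
  split; first by apply: measurable_funM => //; exact: measurable_indic.
  exists n%:R => x; rewrite /g indicE; case: (asboolP (A n x)) => [Ax|nA].
    by rewrite mem_set// mulr1.
  by rewrite memNset// mulr0 normr0.
have : moment (fun x => f x - g n x) @[n --> \oo] --> 0%E.
  apply: (moment_cvg0 p_ge1 fL).
  - by move=> n; apply: measurable_funB => //; case: (bg n).
  - move=> n x; rewrite /g indicE.
    by case: (_ \in _); rewrite ?mulr1 ?mulr0 ?subrr ?subr0 ?normr0.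
  - apply: aeW => x; apply: cvg_near_cst.
    exists (Num.truncn `|f x|).+1 => // n /= fn.
    rewrite /g indicE mem_set ?mulr1 ?subrr//= /A /=.
    by rewrite (le_trans (ltW (truncnS_gt _)))// ler_nat.
by move=> /cvge0_exists_le/(_ e0)[n gn]; exists (g n).
Qed.

(** Birkhoff's theorem gives convergence almost everywhere; the uniform bound on the time averages
    upgrades it to convergence of moments. *)
Lemma mean_ergodic_approx (g : X -> R) (e : R) : 0 < e -> bounded_mfun g ->
  exists N, (moment (fun x => time_avg S g N x - \int[mu]_y g y)%R <= e%:E)%E.
Proof.
move=> e0 bg; have [mg [K gK]] := bg; set c := \int[mu]_y g y.
have mtav n : measurable_fun [set: X] (time_avg S g n).
  by case: (bounded_mfun_time_avg n (mpt_fun_mp S).1 bg).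
have : moment (fun x => time_avg S g n x - c) @[n --> \oo] --> 0%E.
  apply: (moment_cvg0 p_ge1 (G := cst (`|K| + `|c|))); first exact: Lfun_cst.
  - by move=> n; apply: measurable_funB => //; exact: measurable_cst.
  - move=> n x; rewrite (le_trans (ler_normB _ _))//= [leRHS]ger0_norm ?addr_ge0//.
    by rewrite lerD2r (le_trans (time_avg_bounded S n x gK))// ler_norm.
  - have := time_avg_cvg (mpt_fun_mp S) ergS bg; apply: filterS => x hx.
    by rewrite -(subrr c); apply: cvgB => //; exact: cvg_cst.
by move=> /cvge0_exists_le/(_ e0).
Qed.

(** With [g] a truncation of [f] and [h = (f - g) + (time_avg S g N - c)], the function [f - c - h]
    is [g - time_avg S g N], whose averages tend to 0 at every point. *)
Lemma small_remainder (f : X -> R) (e : R) : 0 < e -> f \in Lfun mu p%:E ->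
  exists h c, [/\ h \in Lfun mu p%:E, (moment h <= e%:E)%E &
    forall x, (M n f x - c - M n h x : R) @[n --> \oo] --> (0 : R)].
Proof.
move=> e0 fL; have [mf _] := (Lfun_momentP mu p_ge1 f).1 fL.
(* The denominator compensates the constant of [momentD_le] and the two summands of [h]. *)
pose e' := e / (2 `^ p * 2).
have p2 : 0 < 2 `^ p :> R by rewrite powR_gt0.
have e'0 : 0 < e' by rewrite divr_gt0// mulr_gt0.
have [g bg fg] := truncation_approx e'0 fL.
have [N hN] := mean_ergodic_approx e'0 bg.
have [mg [K gK]] := bg.
have [mt _] := bounded_mfun_time_avg N (mpt_fun_mp S).1 bg.
set c := \int[mu]_y g y in hN.
pose h x := (f x - g x) + (time_avg S g N x - c).
have m1 : measurable_fun [set: X] (fun x => f x - g x) by exact: measurable_funB.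
have m2 : measurable_fun [set: X] (fun x => time_avg S g N x - c).
  by apply: measurable_funB => //; exact: measurable_cst.
have he : (moment h <= e%:E)%E.
  apply: (le_trans (momentD_le mu p_ge1 m1 m2)).
  apply: (@le_trans _ _ ((2 `^ p)%:E * (e'%:E + e'%:E))%E).
    by apply: lee_wpmul2l; [rewrite lee_fin ltW|exact: leeD].
  rewrite -EFinD -EFinM lee_fin /e' [leLHS](_ : _ = e)//.
  by field; rewrite lt0r_neq0.
exists h, c; split => //.
  apply/Lfun_momentP => //; split; first exact: measurable_funD.
  exact: le_lt_trans he (ltry _).
move=> x; have := ergodic_avg_time_avg_cvg S T processRn N x gK.
apply: cvg_trans; apply: near_eq_cvg; apply: nearW => n /=.
have -> : M n h x = M n f x - M n g x + (M n (time_avg S g N) x - c).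
  rewrite /h ergodic_avgD !ergodic_avgD.
  rewrite (_ : (fun y => - g y) = (fun y => -1 * g y)); last first.
    by apply/funext => y; rewrite mulN1r.
  by rewrite ergodic_avgZ mulN1r ergodic_avg_cst.
by ring.
Qed.

(** If the averages of [f] at [x] fail to come within [2 * l] of a constant, the maximal function of
    every remainder [h m] exceeds [l] at [x]; by the weak type inequality this has measure at most a
    multiple of [1 / (m + 1)] for every [m], hence 0. *)
Lemma weak_type_ae_cvg (f : X -> R) : weak_type mu p Mmax -> f \in Lfun mu p%:E ->
  {ae mu, forall x, cvgn (fun n => M n f x)}.
Proof.
move=> [C C0 wt] fL.
pose osc (l : R) x := exists c : R, \forall n \near \oo, `|M n f x - c| <= 2 * l.
suff ae_osc l : 0 < l -> {ae mu, forall x, osc l x}.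
  (* Countably many values of [l] suffice for the Cauchy criterion. *)
  have H := ae_foralln (fun k => ae_osc k.+1%:R^-1 (ltac:(by rewrite invr_gt0))).
  apply: filterS H => x hx; apply: cauchy_cvg; apply: cauchy_exP => e e0.
  pose k := Num.truncn (2 / e).
  have ke : 2 * k.+1%:R^-1 < e.
    by rewrite ltr_pdivrMr// mulrC -ltr_pdivrMr// truncnS_gt.
  have [c hc] := hx k; exists c; apply: filterS hc => n hn.
  by rewrite /ball /= distrC (le_lt_trans hn).
move=> l0.
have e0 (m : nat) : (0 : R) < m.+1%:R^-1 by rewrite invr_gt0.
have /choice[h hP] m := small_remainder (e0 m) fL.
pose B m := [set x | (l%:E < Mmax (h m) x)%E].
have mB m : measurable (B m).
  have [c [hL _ _]] := hP m; apply: measurable_maximal_op_gt.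
  exact: ((Lfun_momentP mu p_ge1 _).1 hL).1.
have mD : measurable (\bigcap_m B m) by exact: bigcapT_measurable.
have D0 : mu (\bigcap_m B m) = 0%E.
  have C' : 0 < C * l^-1 `^ p by rewrite mulr_gt0// powR_gt0// invr_gt0.
  have bnd m : fine (mu (\bigcap_m B m)) <= C * l^-1 `^ p * m.+1%:R^-1.
    have [c [hL he _]] := hP m.
    rewrite -lee_fin fineK ?fin_num_measure//.
    apply: (@le_trans _ _ (mu (B m))).
      by apply: le_measure; rewrite ?inE//; exact: bigcap_inf.
    apply: (le_trans (wt _ hL _ l0)); rewrite weak_type_bound// [X in (_ <= X)%E]EFinM.
    by apply: lee_wpmul2l => //; rewrite lee_fin ltW.
  apply/eqP; rewrite -[mu _]fineK ?fin_num_measure// eqe eq_le fine_ge0// andbT.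
  rewrite leNgt; apply/negP; set a := fine _ in bnd * => a0.
  (* For this index the bound drops below the positive number [a]. *)
  have := bnd (Num.truncn (C * l^-1 `^ p / a)); rewrite leNgt => /negP; apply.
  by rewrite ltr_pdivrMr// [a * _]mulrC -ltr_pdivrMr// truncnS_gt.
exists (\bigcap_m B m); split => // x /= nosc m _.
apply: contrapT => nB; apply: nosc.
have [c [_ _ /(_ x)/cvgrPdist_le/(_ _ l0) hc]] := hP m; exists c.
apply: filterS hc => n; rewrite sub0r normrN => hn.
have Mh : `|M n (h m) x| <= l.
  rewrite (le_trans (ergodic_avg_norm _ _ _ _ _ _))// leNgt; apply/negP => lM.
  by apply: nB; apply/maximal_op_gtP; exists n.
rewrite -[M n f x - c](subrK (M n (h m) x)) (le_trans (ler_normD _ _))//.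
by rewrite mulr_natl mulr2n lerD.
Qed.

End banach_principle.

Theorem theorem1p1 (R : realType) (d : measure_display) (X : measurableType d)
    (mu : probability X R) (S T : invertible_mpt mu)
    (ergS : ergodic mu S) (ergT : ergodic mu T)
    (commST : forall x, S (T x) = T (S x))
    (freeST : forall i j : int, (i, j) <> (0, 0) ->
       mu.-negligible [set x | mpt_iter S i (mpt_iter T j x) = x])
    (Rn : nat -> rectangle R) (processRn : is_process Rn)
    (p : R) (p_ge1 : 1 <= p) :
  (forall f : X -> R, f \in Lfun mu p%:E ->
     {ae mu, forall x, cvgn (fun n => ergodic_avg S T Rn n f x)})
  <->
  weak_type mu p (maximal_op S T Rn).
Proof.
split=> [ae_cvg|wt f fL]; last first.
  exact: (weak_type_ae_cvg ergS processRn p_ge1 wt fL).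
apply: maximal_weak_type => // F FL F0.
(* A convergent sequence is bounded; every number strictly above [B] is a bound, hence [B + 1]. *)
apply: filterS (ae_cvg F FL) => x /cvg_seq_bounded[B [_ hB]].
exists (B + 1) => n; rewrite (le_trans (ler_norm _))//.
by apply: hB => //; rewrite ltrDl.
Qed.
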